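(* Let $p$ be a prime and let $G$ be a maximal class $p$-group with $|G|=p^n$ such that $\mathrm{cd}(G)=\{1,p,p^b\}$ for some integer $b\ge 2$. Then $\mathrm{cod}(G)=\{p^i\mid 0\le i\le c\}$ for some integer $c$ with $n-b\le c\le n-2$.
   Context: All groups are finite. $\mathrm{Irr}(G)$ is the set of irreducible complex characters of $G$, and $\mathrm{cd}(G)=\{\chi(1)\mid \chi\in\mathrm{Irr}(G)\}$ is the set of character degrees. The codegree of $\chi\in\mathrm{Irr}(G)$ is $\mathrm{cod}(\chi)=|G:\ker(\chi)|/\chi(1)$, and $\mathrm{cod}(G)=\{\mathrm{cod}(\chi)\mid\chi\in\mathrm{Irr}(G)\}$. A $p$-group of order $p^n$ has maximal class if its nilpotence class is $n-1$. *)

(* Defs.v *)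
(* Complex characters are taken over algC: every complex character of a finite
   group has algebraic values. *)
From mathcomp Require Import all_boot all_order all_algebra.
From mathcomp Require Import all_fingroup all_solvable all_field all_character.

Set Implicit Arguments.
Unset Strict Implicit.
Unset Printing Implicit Defensive.

Import GRing.Theory.
Local Open Scope ring_scope.

(* cd(G) and cod(G) are sequences, possibly with repetitions, to be compared
   as sets with =i. *)
Definition cd (gT : finGroupType) (G : {group gT}) : seq algC :=
  [seq 'chi[G]_i 1%g | i : Iirr G].

Definition codegree (gT : finGroupType) (G : {group gT}) (chi : 'CF(G)) : algC :=
  #|G : cfker chi|%g%:R / chi 1%g.

Definition cod (gT : finGroupType) (G : {group gT}) : seq algC :=
  [seq codegree 'chi[G]_i | i : Iirr G].

(* Nilpotence class n - 1 is written with a successor to avoid the truncated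
   subtraction. *)
Definition maximal_class_pgroup (p n : nat) (gT : finGroupType)
    (G : {group gT}) : Prop :=
  [/\ (p.-group G)%g, #|G| = (p ^ n)%N & (nil_class G).+1 = n].

(* Main.v *)
(* Put L_i for the i-th term of the lower central series. In a p-group of
   maximal class the normal subgroups of index p^i, i >= 2, are exactly the L_i,
   and every L_i with i >= 3 is the kernel of some irreducible character; all
   those kernels belong to nonlinear characters.
   If chi has degree p, then G has a subgroup M of index p with M' contained in
   ker chi, so every psi whose kernel contains ker chi has degree at most
   |G : M| = p. Hence for some m < n all characters with kernel L_i have degree p
   if 3 <= i <= m, and degree p^b if m < i <= n. The codegrees are therefore 1
   and p (linear characters), p^2, ..., p^(m-1) and p^(m+1-b), ..., p^(n-b), and
   the two ranges leave no gap. *)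
Require Import Defs.
From mathcomp Require Import all_boot all_order all_algebra.
From mathcomp Require Import all_fingroup all_solvable all_field all_character.
From mathcomp Require Import zify.

Set Implicit Arguments.
Unset Strict Implicit.
Unset Printing Implicit Defensive.

Import Order.TTheory GRing.Theory Num.Theory.
Local Open Scope ring_scope.

(** * Character degrees in p-groups *)

(** ['chi_i] is a constituent of the character induced from a linear constituent of its restriction
    to [M]. *)
Lemma irr1_le_index (gT : finGroupType) (G M : {group gT}) (i : Iirr G) :
  M \subset G -> (M^`(1) \subset cfker 'chi_i)%g ->
  'chi_i 1%g <= #|G : M|%g%:R.
Proof.
move=> sMG sM'K; have [j Mj] := constt_cfRes_irr M i.
have linj : 'chi_j \is a linear_char.
  rewrite lin_irr_der1 (subset_trans _ (cfker_constt _ Mj)) ?cfRes_char ?irr_char //.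
  by rewrite sub_cfker_Res ?der_sub.
have <-: 'Ind[G] 'chi_j 1%g = #|G : M|%g%:R by rewrite cfInd1 // lin_char1 ?mulr1.
by rewrite char1_ge_constt ?cfInd_char ?irr_char // constt_Ind_Res.
Qed.

Lemma pgroup_irr1 (p : nat) (gT : finGroupType) (G : {group gT}) (i : Iirr G) :
  prime p -> (p.-group G)%g -> exists k, 'chi_i 1%g = (p ^ k)%N%:R.
Proof.
move=> p_pr /p_natP[n oG]; have := dvd_irr1_cardG i.
rewrite irr1_degree oG dvdC_nat => /(dvdn_pfactor _ _ p_pr)[k _ ->].
by exists k.
Qed.

(* Counting degrees modulo p in chi * chi^*, where the principal character has
   multiplicity 1, yields a nonprincipal linear constituent. *)
Lemma pgroup_irr_stab_lin (p : nat) (gT : finGroupType) (G : {group gT})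
    (i : Iirr G) :
  prime p -> (p.-group G)%g -> 'chi_i 1%g != 1 ->
  exists2 k : Iirr G, k != 0 & 'chi_k \is a linear_char /\ 'chi_k * 'chi_i = 'chi_i.
Proof.
move=> p_pr pG nlin; pose X := 'chi_i * ('chi_i)^*%CF.
have pdvd (k : Iirr G) : 'chi_k 1%g != 1 -> (p %| 'chi_k 1%g)%C.
  have [[|e] ->] := pgroup_irr1 k p_pr pG; first by rewrite expn0 eqxx.
  by rewrite dvdC_nat expnS dvdn_mulr.
have NX : X \is a character by rewrite rpredM ?cfConjC_char ?irr_char.
(* For linear ['chi_k] the product ['chi_k * 'chi_i] is irreducible, so a nonzero multiplicity
   forces it to equal ['chi_i]. *)
have dotX k : '[X, 'chi_k] = '['chi_i, 'chi_k * 'chi_i].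
  rewrite !cfdotE; congr (_ * _); apply: eq_bigr => x _.
  by rewrite !cfunE rmorphM /= -mulrA [_^* * _]mulrC.
suff /existsP[k /and3P[nz_k lin_k nz_d]] :
    [exists k : Iirr G, [&& k != 0, 'chi_k \is a linear_char & '[X, 'chi_k] != 0]].
  exists k => //; split => //.
  have /irrP[j Dj] := mul_lin_irr lin_k (mem_irr i).
  by move: nz_d; rewrite dotX Dj cfdot_irr; have [-> | _] := eqVneq i j; rewrite ?eqxx.
apply: contraT => /existsPn noX; have: (p %| X 1%g)%C.
  have [[|e] De] := pgroup_irr1 i p_pr pG; first by rewrite De eqxx in nlin.
  by rewrite cfunE cfConjCE De rmorph_nat -natrM dvdC_nat expnS -mulnA dvdn_mulr.
rewrite (cfun_sum_cfdot X) sum_cfunE (bigD1 0) //= cfunE.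
rewrite dotX irr0 mul1r cfnorm_irr cfun11 mulr1.
rewrite rpredDr; first by rewrite (dvdC_nat p 1) dvdn1 => /eqP p1; rewrite p1 in p_pr.
apply: rpred_sum => k nz_k; rewrite cfunE; have := noX k; rewrite nz_k /= negb_and negbK.
case/orP=> [nlin_k | /eqP ->]; last by rewrite mul0r dvdC0.
rewrite dvdC_mull ?intr_nat ?Cnat_cfdot_char_irr //.
by apply: pdvd; move: nlin_k; rewrite qualifE /= irr_char.
Qed.

(* A linear mu <> 1 with mu * chi = chi makes chi vanish off ker mu. So if M is
   maximal and contains ker mu, then the restriction of chi to M has norm p;
   being reducible of degree p, it is a sum of linear characters. *)
Lemma pgroup_irr_deg_prime (p : nat) (gT : finGroupType) (G : {group gT})
    (i : Iirr G) :
    prime p -> (p.-group G)%g -> 'chi_i 1%g = p%:R ->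
  exists2 M : {group gT}, M \subset G /\ #|G : M|%g = p
    & (M^`(1) \subset cfker 'chi_i)%g.
Proof.
move=> p_pr pG deg_i.
have [|k nz_k [lin_k stab_k]] := pgroup_irr_stab_lin p_pr pG (i := i).
  by rewrite deg_i pnatr_eq1 neq_ltn prime_gt1 ?orbT.
have [defG | [M maxM sKM]] := maximal_exists (cfker_sub 'chi_k).
  by case/negP: nz_k; rewrite -subGcfker defG.
have [sMG iMG] := (maxgroupp maxM, p_maximal_index pG maxM).
have {}sMG: M \subset G by rewrite proper_sub.
exists M => //.
have onM: 'chi_i \in 'CF(G, M).
  apply/cfun_onP=> x notMx; have [Gx | /cfun0-> //] := boolP (x \in G).
  apply: contraNeq notMx => nz_x; apply: (subsetP sKM).
  rewrite /= cfkerEirr inE lin_char1 //.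
  by apply/eqP/(mulIf nz_x); rewrite mul1r -[in RHS]stab_k cfunE.
have normM: '['Res[M] 'chi_i] = p%:R.
  by rewrite (eqTleif (cfnorm_Res_leif _ sMG) onM) cfnorm_irr mulr1 iMG.
have NRes: 'Res[M] 'chi_i \is a character by rewrite cfRes_char ?irr_char.
suff: (M^`(1) \subset cfker ('Res[M] 'chi_i))%g.
  by rewrite cfker_Res ?irr_char // subsetI => /andP[].
rewrite cfkerE // subsetI der_sub; apply/bigcapsP=> j Rj.
rewrite -lin_irr_der1 qualifE /= irr_char /=.
have [[|e] De] := pgroup_irr1 j p_pr (pgroupS sMG pG); first by rewrite De.
have [chi Nchi DRes] := constt_charP j NRes Rj.
(* A constituent of degree at least [p] exhausts the restriction, whose norm would then be 1 instead
   of [p]. *)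
have chi0: chi = 0.
  apply/eqP; rewrite -char1_eq0 // eq_le char1_ge0 // andbT.
  have /eqP := congr1 (fun f : 'CF(M) => f 1%g) DRes.
  rewrite cfRes1 deg_i cfunE De addrC -subr_eq => /eqP <-; rewrite subr_le0 ler_nat.
  by rewrite -[X in (X <= _)%N]muln1 expnS leq_mul2l expn_gt0 prime_gt0 ?orbT.
move: normM; rewrite DRes chi0 addr0 cfnorm_irr => /eqP.
by rewrite eq_sym pnatr_eq1 => /eqP p1; rewrite p1 in p_pr.
Qed.

Lemma irr1_le_prime (p : nat) (gT : finGroupType) (G : {group gT})
    (i j : Iirr G) :
    prime p -> (p.-group G)%g -> 'chi_i 1%g = p%:R ->
    (cfker 'chi_i \subset cfker 'chi_j)%g ->
  'chi_j 1%g <= p%:R.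
Proof.
move=> p_pr pG deg_i sK; have [M [sMG iMG] sM'K] := pgroup_irr_deg_prime p_pr pG deg_i.
by rewrite -[in _%:R]iMG irr1_le_index // (subset_trans sM'K).
Qed.

(** chi(1)^2 is at most |G : Z(chi)|, which is at most |G : ker chi|. *)
Lemma irr1_exp_le (p e j : nat) (gT : finGroupType) (G : {group gT}) (i : Iirr G) :
    prime p -> 'chi_i 1%g = (p ^ e)%N%:R -> #|G : cfker 'chi_i|%g = (p ^ j)%N ->
  (e * 2 <= j)%N.
Proof.
move=> p_pr deg_i iK; have [le_deg _] := irr1_bound i.
rewrite -(leq_exp2l _ _ (prime_gt1 p_pr)) expnM -iK -(ler_nat algC) natrX -deg_i.
rewrite (le_trans le_deg) // ler_nat dvdn_leq ?indexgS //.
by rewrite normal_sub ?cfker_center_normal.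
Qed.

(** * Lower central series in maximal class *)

Section MaximalClass.
Variables (p n : nat) (gT : finGroupType) (G : {group gT}).
Hypotheses (p_pr : prime p) (maxG : maximal_class_pgroup p n G) (n3 : (2 < n)%N).

Let pG : (p.-group G)%g. Proof. by case: maxG. Qed.
Let oG : #|G| = (p ^ n)%N. Proof. by case: maxG. Qed.
Let nG : nilpotent G. Proof. exact: pgroup_nil pG. Qed.

Lemma lcn_proper_step i : (0 < i < n)%N -> ('L_i.+1(G) \proper 'L_i(G))%g.
Proof.
case: i => // i /= ltin; rewrite lcnSn (nil_comm_properl nG) ?lcn_sub //.
  have [_ _ En] := maxG; move: ltin; rewrite -En ltnS => lt_class.
  by apply/eqP => /(lcn_nil_classP _ nG); rewrite leqNgt lt_class.
by rewrite subsetI subxx lcn_norm.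
Qed.

(** A nilpotent group with cyclic abelianization is cyclic, hence of class at most 1, whereas the
    class here is n - 1 >= 2. *)
Lemma maxclass_der1_noncyclic : ~~ cyclic (G / G^`(1))%g.
Proof.
apply/negP => /(cyclic_nilpotent_quo_der1_cyclic nG)/cyclic_abelian.
by rewrite -nil_class1 -ltnS; have [_ _ ->] := maxG; rewrite leqNgt n3.
Qed.

(** Strict descent bounds the orders from below, counting up from L_n. From above, the noncyclic
    G/L_2 has order at least p^2, and each later step loses at least one more factor p. *)
Lemma card_lcn i : (1 < i <= n)%N -> #|'L_i(G)%g| = (p ^ (n - i))%N.
Proof.
case/andP=> i1 lein; have pL j := pgroupS (lcn_sub j G) pG.
have step j : (0 < j < n)%N -> (logn p #|'L_j.+1(G)%g| < logn p #|'L_j(G)%g|)%N.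
  by move=> /lcn_proper_step; apply: properG_ltn_log.
have lower k : (k < n)%N -> (k <= logn p #|'L_(n - k)(G)%g|)%N.
  elim: k => // k IHk ltkn; apply: leq_ltn_trans (IHk (ltnW ltkn)) _.
  by rewrite -(subnSK (ltnW ltkn)) step // subn_gt0 ltkn ltn_subrL (leq_trans _ ltkn).
have upper2 : (logn p #|'L_2(G)%g| + 2 <= n)%N.
  have := step 1%N (ltnW n3); rewrite lcn1 oG pfactorK // addn2 !ltn_neqAle => ->.
  rewrite andbT; apply: contra maxclass_der1_noncyclic => /eqP log2.
  apply: prime_cyclic; rewrite card_quotient ?der_norm // -divgS ?der_sub //.
  have /p_natP[m om] := pL 2%N; move: log2; rewrite om pfactorK // => En.
  by rewrite oG -En -expnB ?prime_gt0 // subSnn expn1.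
have upper k : (k.+2 <= n)%N -> (logn p #|'L_k.+2(G)%g| + k.+2 <= n)%N.
  elim: k => // k IHk ltkn; apply: leq_trans (IHk (ltnW ltkn)).
  by rewrite addnS ltn_add2r step.
rewrite (card_pgroup (pL i)); congr (_ ^ _)%N; apply/eqP; rewrite eqn_leq.
apply/andP; split.
  by rewrite leq_subRL // addnC; case: i i1 lein => [|[|i]] // _; apply: upper.
rewrite -[in logn _ _](subKn lein) lower // ltn_subrL (ltnW i1).
exact: ltn_trans n3.
Qed.

Lemma index_lcn i : (1 < i <= n)%N -> #|G : 'L_i(G)|%g = (p ^ i)%N.
Proof.
move=> in_i; have /andP[_ lein] := in_i.
rewrite -divgS ?lcn_sub // card_lcn // oG -expnB ?prime_gt0 ?leq_subr //.
by rewrite subKn.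
Qed.

(** G/N has order p^i, hence class at most i - 1, so L_i lies in N; the orders agree. *)
Lemma normal_index_lcn (N : {group gT}) i :
  (N <| G)%g -> #|G : N|%g = (p ^ i)%N -> (1 < i)%N -> N = 'L_i(G)%g :> {set gT}.
Proof.
move=> nsNG iN i1; have [sNG nNG] := andP nsNG.
have lein: (i <= n)%N.
  by rewrite -(dvdn_Pexp2l _ _ (prime_gt1 p_pr)) -iN -oG dvdn_indexg.
have cardN : #|N| = #|'L_i(G)%g|.
  apply/eqP; rewrite -(eqn_pmul2r (indexg_gt0 G N)) Lagrange // {1}iN.
  by rewrite -(index_lcn (i := i)) ?i1 // Lagrange ?lcn_sub.
apply/esym/eqP; rewrite eqEcard cardN leqnn andbT.
have pq := quotient_pgroup N pG; rewrite -quotient_sub1 ?(subset_trans (lcn_sub _ _)) //.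
have := nil_class_pgroup pq; rewrite card_quotient // iN pfactorK //.
(* The bound on the class is [maxn 1 i.-1], which is [i.-1] because i >= 2. *)
rewrite (maxn_idPr _) ?ltn_predRL //.
move/(lcn_nil_classP _ (pgroup_nil pq)); rewrite prednK ?(ltnW i1) // => <-.
by rewrite /quotient morphim_lcn.
Qed.

Lemma normal_index_le1 (N : {group gT}) i :
  (N <| G)%g -> #|G : N|%g = (p ^ i)%N -> (i <= 1)%N -> (G^`(1) \subset N)%g.
Proof.
move=> /andP[sNG nNG]; rewrite -card_quotient // => oGN i1.
rewrite der1_min // cyclic_abelian //.
case: i oGN i1 => [|[]] // oGN _; last by rewrite prime_cyclic ?oGN.
by rewrite (card1_trivg oGN) cyclic1.
Qed.

(** * Kernels and codegrees in maximal class *)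

(** L_i is the intersection of the irreducible kernels containing it, so one of them does not
    contain L_(i-1). That kernel is itself a term of the series, and only L_i fits. *)
Lemma exists_irr_ker_lcn i :
  (2 < i <= n)%N -> exists k : Iirr G, cfker 'chi_k = 'L_i(G)%g.
Proof.
case: i => // i /andP[i2 ltin].
have i_bounds: (0 < i < n)%N by rewrite ltin andbT -ltnS ltnW.
have /existsP[k /andP[sLK nsLK]] : [exists k : Iirr G,
    ('L_i.+1(G) \subset cfker 'chi_k)%g && ~~ ('L_i(G) \subset cfker 'chi_k)%g].
  apply: contraLR (lcn_proper_step i_bounds) => /existsPn noK.
  rewrite properE lcn_subS negbK -(cap_cfker_normal (lcn_normal i.+1 G)).
  by apply/bigcapsP=> k sLK; have := noK k; rewrite sLK negbK.
exists k; have /p_natP[j iK] : p.-nat #|G : cfker 'chi_k|%g.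
  exact: pnat_dvd (dvdn_indexg _ _) pG.
have nsK := cfker_normal 'chi_k.
case: (leqP j 1) => [/(normal_index_le1 nsK iK) sG'K | j1].
  by case/negP: nsLK; apply: subset_trans sG'K; rewrite -lcn2 lcn_sub_leq.
have le_ji : (j <= i.+1)%N.
  have i1_bounds : (1 < i.+1 <= n)%N by rewrite ltin ltnW.
  by have := indexgS G sLK; rewrite /= iK (index_lcn i1_bounds) dvdn_Pexp2l ?prime_gt1.
have DK := normal_index_lcn nsK iK j1; rewrite /= in DK; rewrite DK in nsLK *.
suff -> : j = i.+1 by [].
apply/eqP; rewrite eqn_leq le_ji /=.
by rewrite ltnNge; apply: contra nsLK => /lcn_sub_leq.
Qed.

Lemma index_cfker_pow (k : Iirr G) : exists j, #|G : cfker 'chi_k|%g = (p ^ j)%N.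
Proof. by have [j ->] := p_natP (pnat_dvd (dvdn_indexg G (cfker 'chi_k)) pG); exists j. Qed.

(** A kernel of index at least p^2 would be a term of the series containing L_2, hence G' itself;
    but G/ker is cyclic and G/G' is not. *)
Lemma lin_irr_codegree (k : Iirr G) :
  k != 0 -> 'chi_k \is a linear_char -> codegree 'chi_k = p%:R.
Proof.
move=> nz_k lin_k; have [j iK] := index_cfker_pow k.
rewrite /codegree lin_char1 // divr1 iK; case: j iK => [|[|j]] iK //.
  case/negP: nz_k; rewrite -subGcfker; apply/setIidPl.
  by move/eqP: iK; rewrite expn0 indexg_eq1 => /setIidPl.
have DK := normal_index_lcn (cfker_normal 'chi_k) iK isT; rewrite /= in DK.
have j0 : j = 0%N.
  have sL2K : ('L_2(G) \subset cfker 'chi_k)%g by exact: lin_char_der1.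
  have i2_bounds : (1 < 2 <= n)%N := ltnW n3.
  have := indexgS G sL2K; rewrite /= iK (index_lcn i2_bounds) dvdn_Pexp2l ?prime_gt1 //.
  by rewrite !ltnS leqn0 => /eqP.
case/negP: maxclass_der1_noncyclic; rewrite j0 lcn2 in DK; rewrite -DK.
(* The centre of a linear character is all of [G]. *)
have := cfcenter_cyclic 'chi_k; congr (is_true (cyclic (_ / _)%g)).
apply/setP=> x; have [Gx | notGx] := boolP (x \in G).
  by rewrite irr_cfcenterE // normC_lin_char ?lin_char1 ?eqxx.
by apply: contraNF notGx; apply/subsetP/cfcenter_sub.
Qed.

(** A normal subgroup of index at most p^2 contains G', which the kernel of a nonlinear character
    does not. *)
Lemma nonlin_irr_ker (k : Iirr G) :
    'chi_k 1%g != 1 ->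
  exists2 i, (2 < i <= n)%N & cfker 'chi_k = 'L_i(G)%g.
Proof.
move=> nlin_k; have [i iK] := index_cfker_pow k; have nsK := cfker_normal 'chi_k.
have nsG'K: ~~ (G^`(1) \subset cfker 'chi_k)%g.
  by apply: contra nlin_k; rewrite -lin_irr_der1 => /lin_char1 ->.
case: (leqP i 1) => [/(normal_index_le1 nsK iK) | i1]; first by rewrite (negPf nsG'K).
have DK := normal_index_lcn nsK iK i1; exists i => //.
have -> : (i <= n)%N.
  by have := dvdn_indexg G (cfker 'chi_k); rewrite /= iK oG dvdn_Pexp2l ?prime_gt1.
rewrite andbT ltn_neqAle i1 andbT.
by apply: contraNneq nsG'K => i2; rewrite /= in DK; rewrite DK -i2.
Qed.

Lemma ker_lcn_nonlin (k : Iirr G) i :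
  (2 < i <= n)%N -> cfker 'chi_k = 'L_i(G)%g -> 'chi_k 1%g != 1.
Proof.
case/andP=> i2 lein DK; apply/negP => lin_k.
have : 'chi_k \is a linear_char by rewrite qualifE /= irr_char.
rewrite lin_irr_der1 DK -lcn2 => /(indexgS G)/(dvdn_leq (indexg_gt0 _ _)).
by rewrite !index_lcn ?lein ?(ltnW i2) ?(ltnW n3) // leq_exp2l ?prime_gt1 // leqNgt i2.
Qed.

Lemma codegree_ker_lcn (k : Iirr G) i e :
    (2 < i <= n)%N -> cfker 'chi_k = 'L_i(G)%g -> 'chi_k 1%g = (p ^ e)%N%:R ->
  codegree 'chi_k = (p ^ (i - e))%N%:R.
Proof.
case/andP=> i2 lein DK deg_k; have iK: #|G : cfker 'chi_k|%g = (p ^ i)%N.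
  by rewrite DK index_lcn // (ltnW i2).
(* This gives e <= i, so the subtraction [i - e] is not truncated. *)
have le_e2 := irr1_exp_le p_pr deg_k iK.
rewrite /codegree iK deg_k -natf_div ?dvdn_exp2l -?expnB ?prime_gt0 //;
  by rewrite (leq_trans _ le_e2) // leq_pmulr.
Qed.

Lemma has_nonprincipal_lin : exists2 k : Iirr G, k != 0 & 'chi_k \is a linear_char.
Proof.
have [||k lin_k nz_k] := @solvable_has_lin_char _ G.
- by rewrite -cardG_gt1 oG -(expn0 p) ltn_exp2l ?prime_gt1 // ltnW // ltnW.
- exact: nilpotent_sol.
by exists k; rewrite // -irr_eq1.
Qed.

End MaximalClass.

(** * The set of codegrees *)

Theorem theoremB (p n b : nat) (gT : finGroupType) (G : {group gT})
    (p_prime : prime p)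
    (G_maxclass : maximal_class_pgroup p n G)
    (b_ge2 : (2 <= b)%N)
    (cdG : cd G =i [:: 1; p%:R; (p ^ b)%N%:R]) :
  exists c : nat,
    [/\ (n <= c + b)%N, (c + 2 <= n)%N
      & cod G =i [seq (p ^ i)%N%:R | i <- iota 0 c.+1]].
Proof.
have [pG oG _] := G_maxclass; have p_gt1 := prime_gt1 p_prime.
have degE (k : Iirr G) :
    [\/ 'chi_k 1%g = 1, 'chi_k 1%g = p%:R | 'chi_k 1%g = (p ^ b)%N%:R].
  have : 'chi_k 1%g \in cd G by apply: codom_f.
  by rewrite cdG !inE => /or3P[] /eqP ->; [constructor 1 | constructor 2 | constructor 3].
have [k0 deg_k0] : exists k : Iirr G, 'chi_k 1%g = (p ^ b)%N%:R.
  have : (p ^ b)%N%:R \in cd G by rewrite cdG !inE eqxx !orbT.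
  by case/imageP=> k _ ->; exists k.
have [j0 iK0] := p_natP (pnat_dvd (dvdn_indexg G (cfker 'chi_k0)) pG).
have le_bn : (b * 2 <= n)%N.
  apply: leq_trans (irr1_exp_le p_prime deg_k0 iK0) _.
  by rewrite -(dvdn_Pexp2l _ _ p_gt1) -iK0 -oG dvdn_indexg.
have n3 : (2 < n)%N by lia.
have not_pb_le_p: ~ (p ^ b)%N%:R <= p%:R :> algC.
  by rewrite ler_nat -{2}(expn1 p) leq_exp2l // leqNgt b_ge2.
(* The threshold [m] will be the largest index satisfying [Q]. *)
pose Q i := (2 < i <= n)%N &&
  [exists k : Iirr G, (cfker 'chi_k == 'L_i(G)%g) && ('chi_k 1%g == p%:R)].
have exQ : exists i, Q i.
  (* With kernel L_3, degree p^b would need 2b <= 3. *)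
  exists 3%N; rewrite /Q n3 /=.
  have [|k Dk] := exists_irr_ker_lcn p_prime G_maxclass n3 (i := 3); first by rewrite n3.
  apply/existsP; exists k; rewrite Dk eqxx /=.
  have [deg_k | -> // | deg_k] := degE k.
    by have := ker_lcn_nonlin p_prime G_maxclass n3 (i := 3) n3 Dk; rewrite deg_k eqxx.
  have := irr1_exp_le p_prime deg_k; rewrite Dk => /(_ 3%N).
  by rewrite (index_lcn p_prime G_maxclass n3 (i := 3)) // => /(_ erefl); lia.
have leQ i : Q i -> (i <= n)%N by case/andP=> /andP[].
have [m Qm maxQ] := ex_maxnP exQ leQ.
have /andP[/andP[m2 _] /existsP[l /andP[/eqP Dl /eqP deg_l]]] := Qm.
have degQ (k : Iirr G) i :
    (2 < i <= m)%N -> cfker 'chi_k = 'L_i(G)%g -> 'chi_k 1%g = p%:R.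
  move=> /andP[i2 leim] Dk; have in_i: (2 < i <= n)%N by rewrite i2 (leq_trans leim) ?leQ.
  have := irr1_le_prime p_prime pG deg_l (j := k).
  rewrite Dl Dk lcn_sub_leq // => /(_ isT) le_deg.
  have [deg_k | // | deg_k] := degE k; last by rewrite deg_k in le_deg.
  by have := ker_lcn_nonlin p_prime G_maxclass n3 in_i Dk; rewrite deg_k eqxx.
have degNQ (k : Iirr G) i :
    (m < i <= n)%N -> cfker 'chi_k = 'L_i(G)%g -> 'chi_k 1%g = (p ^ b)%N%:R.
  move=> /andP[ltmi lein] Dk; have in_i: (2 < i <= n)%N by rewrite lein (ltn_trans m2).
  have [deg_k | deg_k | //] := degE k.
    by have := ker_lcn_nonlin p_prime G_maxclass n3 in_i Dk; rewrite deg_k eqxx.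
  have /maxQ : Q i by rewrite /Q in_i; apply/existsP; exists k; rewrite Dk deg_k !eqxx.
  by rewrite leqNgt ltmi.
have lt_mn : (m < n)%N.
  have nlin_k0 : 'chi_k0 1%g != 1.
    by rewrite deg_k0 pnatr_eq1 -(expn0 p) eqn_exp2l //; lia.
  have [i /andP[i2 lein] Dk0] := nonlin_irr_ker p_prime G_maxclass n3 nlin_k0.
  rewrite (leq_trans _ lein) // ltnNge; apply/negP => leim; apply: not_pb_le_p.
  by rewrite -deg_k0 (degQ _ i) ?i2.
(* These are the top exponents coming from degrees p and p^b; both are at most n - 2, by m < n and b
   >= 2. *)
exists (maxn m.-1 (n - b)); split; [lia | lia |].
move=> x; apply/imageP/mapP => [[k _ ->] | [t]].
  have [-> | nz_k] := eqVneq k 0.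
    exists 0%N; first by rewrite mem_iota.
    by rewrite /codegree cfker_irr0 indexgg irr0 cfun11 divr1.
  have [deg_k | nlin_k] := eqVneq ('chi_k 1%g) 1.
    exists 1%N; first by rewrite mem_iota; lia.
    rewrite (lin_irr_codegree p_prime G_maxclass n3) //.
    by rewrite qualifE /= irr_char deg_k eqxx.
  have [i in_i Dk] := nonlin_irr_ker p_prime G_maxclass n3 nlin_k.
  have [leim | ltmi] := leqP i m.
    exists (i - 1)%N; first by rewrite mem_iota; lia.
    apply: (codegree_ker_lcn p_prime G_maxclass n3 in_i Dk).
    by rewrite (degQ k i) //; lia.
  exists (i - b)%N; first by rewrite mem_iota; lia.
  apply: (codegree_ker_lcn p_prime G_maxclass n3 in_i Dk).
  by apply: degNQ Dk; lia.
rewrite mem_iota add0n ltnS => /andP[_ le_tc] ->.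
case: t le_tc => [|[|t]] le_tc.
- by exists 0; rewrite // /codegree cfker_irr0 indexgg irr0 cfun11 divr1.
- have [k nz_k lin_k] := has_nonprincipal_lin p_prime G_maxclass n3.
  by exists k; rewrite // (lin_irr_codegree p_prime G_maxclass n3).
(* The exponent t + 2 comes from kernel L_(t+3) and degree p if t + 3 <= m. Otherwise t + 2 <= n -
   b, and kernel L_(t+2+b) lies beyond m and has degree p^b. *)
have [lt_tm | le_mt] := ltnP t.+2 m.
  have [|k Dk] := exists_irr_ker_lcn p_prime G_maxclass n3 (i := t.+3); first lia.
  exists k; rewrite // (codegree_ker_lcn p_prime G_maxclass n3 (e := 1) _ Dk) ?subn1 //.
    lia.
  by rewrite (degQ k t.+3).
have [|k Dk] := exists_irr_ker_lcn p_prime G_maxclass n3 (i := t.+2 + b); first lia.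
exists k; rewrite // (codegree_ker_lcn p_prime G_maxclass n3 (e := b) _ Dk) ?addnK //.
  lia.
by apply: degNQ Dk; lia.
Qed.
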